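(* Let $(X,\sigma,\tau)$ be a non-degenerate solution and let $k\geq 0$ be an integer. The following conditions are equivalent: (i) $(X,\sigma,\tau)$ is a multipermutation solution of level at most $k$; (ii) the equations $$\Omega_k(\gamma^{(k)},\ldots,\gamma^{(1)},x,z_1,\ldots,z_k)=\Omega_k(\gamma^{(k)},\ldots,\gamma^{(1)},y,z_1,\ldots,z_k)$$ are satisfied for all $x,y,z_1,\ldots,z_k\in X$ and all $k$-tuples $(\gamma^{(1)},\ldots,\gamma^{(k)})\in\{\sigma,\sigma^{-1},\tau,\tau^{-1}\}^k$; (iii) the same equations are satisfied for all $x,y,z_1,\ldots,z_k\in X$ and all $k$-tuples $(\gamma^{(1)},\ldots,\gamma^{(k)})\in\{\sigma,\tau\}^k$.
   Context: A (set-theoretic) solution (of the Yang-Baxter equation) $(X,\sigma,\tau)$ is a non-empty set $X$ (of arbitrary cardinality) with maps $\sigma,\tau\colon X^2\to X$ such that, writing $\sigma_x(y)=\sigma(x,y)$ and $\tau_y(x)=\tau(x,y)$, the map $r\colon X^2\to X^2$, $r(x,y)=(\sigma_x(y),\tau_y(x))$ satisfies the braid relation $(\mathrm{id}\times r)(r\times \mathrm{id})(\mathrm{id}\times r)=(r\times \mathrm{id})(\mathrm{id}\times r)(r\times \mathrm{id})$ on $X^3$. It is non-degenerate if all $\sigma_x$ and all $\tau_y$ are bijections of $X$; then $\sigma^{-1},\tau^{-1}$ denote the families $(\sigma_x^{-1})_{x\in X}$, $(\tau_x^{-1})_{x\in X}$. Terms $\Omega_i$: for families of maps $\gamma^{(j)}=(\gamma^{(j)}_x\colon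 X\to X)_{x\in X}$ put $\Omega_0(x)=x$ and, for $i\ge 1$, $$\Omega_i(\gamma^{(i)},\ldots,\gamma^{(1)},x,z_1,\ldots,z_i)=\gamma^{(i)}_{\Omega_{i-1}(\gamma^{(i-1)},\ldots,\gamma^{(1)},x,z_1,\ldots,z_{i-1})}(z_i).$$ Retraction: for a non-degenerate solution let $x\sim y$ iff $\sigma_x=\sigma_y$ and $\tau_x=\tau_y$. It is known that $\sigma_{x^\sim}(y^\sim)=\sigma_x(y)^\sim$, $\tau_{y^\sim}(x^\sim)=\tau_y(x)^\sim$ are well defined on the set of $\sim$-classes and form a non-degenerate solution $\mathrm{Ret}(X,\sigma,\tau)$. Put $\mathrm{Ret}^0(X,\sigma,\tau)=(X,\sigma,\tau)$ and $\mathrm{Ret}^k=\mathrm{Ret}(\mathrm{Ret}^{k-1})$ for $k\ge1$. The solution has multipermutation level $k$ if $k\ge 0$ is the least integer such that $\mathrm{Ret}^k(X,\sigma,\tau)$ has exactly one element; it is a multipermutation solution of level at most $k$ if such a least integer exists and is $\leq k$. *)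

(* Defs.v *)
From mathcomp Require Import all_boot.
From mathcomp Require Import boolp classical_sets.

Set Implicit Arguments.
Unset Strict Implicit.
Unset Printing Implicit Defensive.

Local Open Scope classical_set_scope.

(* A pair of maps X^2 -> X is given by two families of maps X -> X:
   [s x y] is sigma_x(y) and [t y x] is tau_y(x); the subscript always comes
   first, so the second map sends (x, y) to [t y x]. *)
Definition ybr {X : Type} (s t : X -> X -> X) (p : X * X) : X * X :=
  (s p.1 p.2, t p.2 p.1).

Definition r_id {X : Type} (r : X * X -> X * X) (p : X * X * X) : X * X * X :=
  let: (x, y, z) := p in let: (x', y') := r (x, y) in (x', y', z).

Definition id_r {X : Type} (r : X * X -> X * X) (p : X * X * X) : X * X * X :=
  let: (x, y, z) := p in let: (y', z') := r (y, z) in (x, y', z').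

Definition braid {X : Type} (r : X * X -> X * X) : Prop :=
  id_r r \o r_id r \o id_r r =1 r_id r \o id_r r \o r_id r.

Definition nondegenerate {X : Type} (s t : X -> X -> X) : Prop :=
  (forall x, bijective (s x)) /\ (forall y, bijective (t y)).

Record nd_solution : Type := NdSolution {
  carrier :> Type;
  sigma : carrier -> carrier -> carrier;
  tau : carrier -> carrier -> carrier;
  carrier_inhabited : inhabited carrier;
  ybr_braid : braid (ybr sigma tau);
  sigma_tau_nd : nondegenerate sigma tau
}.
Arguments sigma : clear implicits.
Arguments tau : clear implicits.
Arguments ybr_braid : clear implicits.

Lemma bijective_inverse {A B : Type} (f : A -> B) :
  bijective f -> exists g : B -> A, cancel f g /\ cancel g f.
Proof. by case=> g fK gK; exists g. Qed.

Definition bij_inv {A B : Type} (f : A -> B) (bf : bijective f) : B -> A :=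
  sval (cid (bijective_inverse bf)).

Lemma bij_invK {A B : Type} (f : A -> B) (bf : bijective f) :
  cancel f (bij_inv bf).
Proof. by rewrite /bij_inv; case: (cid _) => g []. Qed.

Lemma bij_invKV {A B : Type} (f : A -> B) (bf : bijective f) :
  cancel (bij_inv bf) f.
Proof. by rewrite /bij_inv; case: (cid _) => g []. Qed.

Definition sigma_inv (S : nd_solution) (x : S) : S -> S :=
  bij_inv ((sigma_tau_nd S).1 x).

Definition tau_inv (S : nd_solution) (x : S) : S -> S :=
  bij_inv ((sigma_tau_nd S).2 x).
Arguments sigma_inv : clear implicits.
Arguments tau_inv : clear implicits.

(* [g j] and [z j], j = 0, ..., i - 1, stand for gamma^(j+1) and z_(j+1). *)
Fixpoint Omega {X : Type} (i : nat) :
    ('I_i -> X -> X -> X) -> X -> ('I_i -> X) -> X :=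
  match i with
  | 0 => fun _ x _ => x
  | j.+1 => fun g x z =>
      g ord_max
        (Omega (fun l => g (widen_ord (leqnSn j) l)) x
               (fun l => z (widen_ord (leqnSn j) l)))
        (z ord_max)
  end.

Definition sim {X : Type} (s t : X -> X -> X) (x y : X) : Prop :=
  s x = s y /\ t x = t y.

Section BraidFacts.
Variables (X : Type) (s t : X -> X -> X).
Hypothesis st_braid : braid (ybr s t).

Let braidE x y z :
  [/\ s x (s y z) = s (s x y) (s (t y x) z),
      t (s (t y x) z) (s x y) = s (t (s y z) x) (t z y)
    & t z (t y x) = t (t z y) (t (s y z) x)].
Proof. by have := st_braid (x, y, z); rewrite /= => -[-> <- <-]. Qed.

Lemma sigmaM x y z : s x (s y z) = s (s x y) (s (t y x) z).
Proof. by case: (braidE x y z). Qed.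

Lemma sigma_tauM x y z :
  t (s (t y x) z) (s x y) = s (t (s y z) x) (t z y).
Proof. by case: (braidE x y z). Qed.

Lemma tauM x y z : t z (t y x) = t (t z y) (t (s y z) x).
Proof. by case: (braidE x y z). Qed.

Lemma braid_mirror : braid (ybr t s).
Proof.
move=> [[x y] z]; rewrite /braid /=.
by rewrite (sigmaM z y x) -(sigma_tauM z y x) -(tauM z y x).
Qed.

Hypothesis st_nd : nondegenerate s t.

Let sI x : injective (s x). Proof. exact: bij_inj (st_nd.1 x). Qed.
Let tI x : injective (t x). Proof. exact: bij_inj (st_nd.2 x). Qed.

Lemma eq_comp_bij (f g h : X -> X) : bijective h -> f \o h =1 g \o h -> f = g.
Proof.
by case=> h' _ hK fg; apply: funext => x; rewrite -(hK x); exact: fg.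
Qed.

Lemma sim_sigma x y y' : sim s t y y' -> sim s t (s x y) (s x y').
Proof.
move=> [sy ty]; split.
  apply: (eq_comp_bij (st_nd.1 (t y x))) => z /=.
  by rewrite -sigmaM sy sigmaM ty.
apply: funext => z; apply: (@tI (t y x)).
by rewrite -tauM {2}ty -tauM ty.
Qed.

(* The diagonal map z |-> sigma_z^-1(z) is onto. *)
Lemma sigma_diag_onto y : exists z, s z y = z.
Proof.
have [t' _ tK] := st_nd.2 y.
exists (s (t' y) y); suff -> : s (s (t' y) y) = s (t' y) by [].
apply: (eq_comp_bij (st_nd.1 y)) => z /=.
by rewrite [RHS]sigmaM tK.
Qed.

Lemma sigma_diag_tau x y z : s z x = z ->
  s (t (s x y) z) (t y x) = t (s x y) z.
Proof.
move=> zx; have sw : s (t x z) = s x.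
  by apply: funext => v; apply: (@sI z); rewrite [RHS]sigmaM zx.
by have := sigma_tauM z x y; rewrite zx sw.
Qed.

Lemma sim_sigma_inj x y y' : sim s t (s x y) (s x y') -> sim s t y y'.
Proof.
move=> [su tu]; have [z zx] := sigma_diag_onto x.
have tyx : t y x = t y' x.
  apply: (@sI (t (s x y) z)); rewrite (sigma_diag_tau y zx) {2}tu.
  by rewrite (sigma_diag_tau y' zx) tu.
split; first by apply: funext => v; apply: (@sI x); rewrite (sigmaM x y) (sigmaM x y') su tyx.
by apply: (eq_comp_bij (st_nd.2 x)) => v /=; rewrite (tauM v x y) (tauM v x y') tu tyx.
Qed.

End BraidFacts.

Section Retraction.
Variable S : nd_solution.
Notation s := (sigma S).
Notation t := (tau S).
Notation "x ~~ y" := (sim s t x y) (at level 70, no associativity).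

Definition simclass (x : S) : set S := [set y | x ~~ y].

Definition ret_carrier : Type := {C : set S | exists x, C = simclass x}.

Definition ret_pi (x : S) : ret_carrier :=
  exist _ (simclass x) (ex_intro _ x erefl).

Lemma sim_sym x y : x ~~ y -> y ~~ x.
Proof. by case=> sxy txy; split. Qed.

Lemma sim_trans x y z : x ~~ y -> y ~~ z -> x ~~ z.
Proof. by rewrite /sim => -[-> ->]. Qed.

Lemma simclass_eq x y : x ~~ y -> simclass x = simclass y.
Proof. by move=> [sxy txy]; rewrite /simclass /sim sxy txy. Qed.

Lemma ret_piP x y : ret_pi x = ret_pi y <-> x ~~ y.
Proof.
split=> [[xy]|xy]; last exact/eq_exist/simclass_eq.
by have: simclass y y by []; rewrite -xy.
Qed.

Lemma ret_pi_surj C : exists x, C = ret_pi x.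
Proof. by case: C => C [x Cx]; exists x; apply: eq_exist. Qed.

(* On two classes this is the class of f x y for any representatives x, y
   (ret_sigmaE and ret_tauE below); no representative has to be chosen. *)
Definition class_op (f : S -> S -> S) (C D : set S) : set S :=
  [set z | exists x y, [/\ C x, D y & f x y ~~ z]].

Lemma class_opE f x y :
    (forall x' y', x ~~ x' -> y ~~ y' -> f x y ~~ f x' y') ->
  class_op f (simclass x) (simclass y) = simclass (f x y).
Proof.
move=> fc; apply/seteqP; split=> z /=.
  by move=> [x' [y' [xx' yy']]]; apply: sim_trans; exact: fc.
by move=> fz; exists x, y.
Qed.

Lemma sigma_sim x y x' y' : x ~~ x' -> y ~~ y' -> s x y ~~ s x' y'.
Proof.
by move=> [<- _] yy; exact: (sim_sigma (ybr_braid S) (sigma_tau_nd S) x yy).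
Qed.

Let mirror_nd : nondegenerate t s.
Proof. by split; [exact: (sigma_tau_nd S).2 | exact: (sigma_tau_nd S).1]. Qed.

Lemma tau_sim y x y' x' : y ~~ y' -> x ~~ x' -> t y x ~~ t y' x'.
Proof.
move=> [_ <-] [sx tx].
by case: (sim_sigma (braid_mirror (ybr_braid S)) mirror_nd y (conj tx sx)).
Qed.

Lemma sigma_class_proof (C D : ret_carrier) :
  exists x, class_op s (sval C) (sval D) = simclass x.
Proof.
have [x ->] := ret_pi_surj C; have [y ->] := ret_pi_surj D.
by exists (s x y); apply: class_opE => x' y'; exact: sigma_sim.
Qed.

Lemma tau_class_proof (C D : ret_carrier) :
  exists x, class_op t (sval C) (sval D) = simclass x.
Proof.
have [x ->] := ret_pi_surj C; have [y ->] := ret_pi_surj D.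
by exists (t x y); apply: class_opE => x' y'; exact: tau_sim.
Qed.

Definition ret_sigma (C D : ret_carrier) : ret_carrier :=
  exist _ (class_op s (sval C) (sval D)) (sigma_class_proof C D).

Definition ret_tau (C D : ret_carrier) : ret_carrier :=
  exist _ (class_op t (sval C) (sval D)) (tau_class_proof C D).

Lemma ret_sigmaE x y : ret_sigma (ret_pi x) (ret_pi y) = ret_pi (s x y).
Proof. by apply/eq_exist/class_opE => x' y'; exact: sigma_sim. Qed.

Lemma ret_tauE y x : ret_tau (ret_pi y) (ret_pi x) = ret_pi (t y x).
Proof. by apply/eq_exist/class_opE => x' y'; exact: tau_sim. Qed.

Lemma ret_inhabited : inhabited ret_carrier.
Proof. by case: (carrier_inhabited S) => x; exists; exact: ret_pi x. Qed.

Lemma ret_braid : braid (ybr ret_sigma ret_tau).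
Proof.
move=> [[C D] E]; rewrite /braid /=.
have [x ->] := ret_pi_surj C; have [y ->] := ret_pi_surj D.
have [z ->] := ret_pi_surj E; rewrite !(ret_sigmaE, ret_tauE).
by have /= [-> -> ->] := ybr_braid S (x, y, z).
Qed.

Lemma inj_surj_bijective (A : Type) (f : A -> A) :
  injective f -> (forall y, exists x, f x = y) -> bijective f.
Proof.
move=> fI fS; pose g y := sval (cid (fS y)).
have gK : cancel g f by move=> y; rewrite /g; case: (cid _).
by exists g => // x; apply: fI; rewrite gK.
Qed.

Lemma ret_nd : nondegenerate ret_sigma ret_tau.
Proof.
split=> C; have [x ->] := ret_pi_surj C; apply: inj_surj_bijective.
- move=> D E; have [y ->] := ret_pi_surj D; have [z ->] := ret_pi_surj E.
  rewrite !ret_sigmaE => /ret_piP yz; apply/ret_piP.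
  exact: (sim_sigma_inj (ybr_braid S) (sigma_tau_nd S) yz).
- move=> D; have [y ->] := ret_pi_surj D; have [s' _ sK] := (sigma_tau_nd S).1 x.
  by exists (ret_pi (s' y)); rewrite ret_sigmaE sK.
- move=> D E; have [y ->] := ret_pi_surj D; have [z ->] := ret_pi_surj E.
  rewrite !ret_tauE => /ret_piP [sy ty]; apply/ret_piP.
  by case: (sim_sigma_inj (braid_mirror (ybr_braid S)) mirror_nd (conj ty sy)).
- move=> D; have [y ->] := ret_pi_surj D; have [t' _ tK] := (sigma_tau_nd S).2 x.
  by exists (ret_pi (t' y)); rewrite ret_tauE tK.
Qed.

Definition Ret : nd_solution := NdSolution ret_inhabited ret_braid ret_nd.

End Retraction.

Definition one_element (X : Type) : Prop := exists x : X, forall y : X, y = x.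

Definition multipermutation_level (S : nd_solution) (k : nat) : Prop :=
  one_element (iter k Ret S) /\
  forall j, j < k -> ~ one_element (iter j Ret S).

Definition multipermutation_level_le (S : nd_solution) (k : nat) : Prop :=
  exists m, multipermutation_level S m /\ m <= k.

(* Main.v *)
Require Import Defs.
From mathcomp Require Import all_boot.
From mathcomp Require Import boolp classical_sets.

(* The outermost map of [Omega_(k+1)] is indexed by [Omega_k]. Since [x ~ y] iff
   [gamma_x = gamma_y] for gamma = sigma, tau (and then also for their inverses),
   the equations of length k+1 hold in S iff [Omega_k(x,z) ~ Omega_k(y,z)], that
   is, iff the equations of length k hold in Ret S. By induction they say that
   Ret^k S has one element, for any set of families containing sigma and tau. *)

Local Open Scope classical_set_scope.

Lemma Ret_one_element {S : nd_solution} :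
  one_element S -> one_element (Ret S).
Proof.
move=> [x xP]; exists (ret_pi x) => C.
by have [y ->] := ret_pi_surj C; rewrite (xP y).
Qed.

(** Having one element persists under [Ret], so it passes from the level [m] up to [k]; conversely,
    the least exponent with this property is the level. *)
Lemma multipermutation_level_leP (S : nd_solution) (k : nat) :
  multipermutation_level_le S k <-> one_element (iter k Ret S).
Proof.
split=> [[m [[m1 _] /subnK <-]]|k1].
  by elim: (k - m) => //= n; exact: Ret_one_element.
have exk : exists n, `[< one_element (iter n Ret S) >] by exists k; apply/asboolP.
have [m /asboolP m1 mP] := ex_minnP exk; exists m.
split; last exact/mP/asboolP.
by split=> // j jm /asboolP /mP; rewrite leqNgt jm.
Qed.

(** Names, rather than maps, let one and the same tuple be interpreted both in [S] and in
    [Ret S]. *)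
Inductive family_name := Sigma | SigmaInv | Tau | TauInv.

Definition family (S : nd_solution) (f : family_name) : S -> S -> S :=
  match f with
  | Sigma => sigma S
  | SigmaInv => sigma_inv S
  | Tau => tau S
  | TauInv => tau_inv S
  end.

(** Inverses are picked by choice from a bijectivity proof; uniqueness of the inverse makes the
    result independent of that proof. *)
Lemma bij_inv_eq {A B : Type} (f g : A -> B) (bf : bijective f)
  (bg : bijective g) : f = g -> bij_inv bf = bij_inv bg.
Proof.
move=> fg; apply: funext => y; apply: (bij_inj bf).
by rewrite bij_invKV fg bij_invKV.
Qed.

Lemma family_sim (S : nd_solution) (f : family_name) (x y : S) :
  sim (sigma S) (tau S) x y -> family S f x = family S f y.
Proof. by case: f => -[sxy txy] //=; exact: bij_inv_eq. Qed.

Lemma family_ret (S : nd_solution) (f : family_name) (x y : S) :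
  family (Ret S) f (ret_pi x) (ret_pi y) = ret_pi (family S f x y).
Proof.
case: f => /=; first exact: ret_sigmaE.
(* For an inverse family, apply the corresponding bijection of [Ret S] to both sides and use its
   compatibility with [ret_pi]. *)
- apply: (bij_inj ((sigma_tau_nd (Ret S)).1 (ret_pi x))).
  by rewrite bij_invKV /= ret_sigmaE bij_invKV.
- exact: ret_tauE.
- apply: (bij_inj ((sigma_tau_nd (Ret S)).2 (ret_pi x))).
  by rewrite bij_invKV /= ret_tauE bij_invKV.
Qed.

Lemma Omega_ret (S : nd_solution) (k : nat) (f : 'I_k -> family_name) (x : S)
    (z : 'I_k -> S) :
  Omega (fun j => family (Ret S) (f j)) (ret_pi x) (fun j => ret_pi (z j)) =
  ret_pi (Omega (fun j => family S (f j)) x z).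
Proof. by elim: k f z => //= k IH f z; rewrite IH family_ret. Qed.

(** The set [F] of allowed names is a parameter, so that conditions (ii) and (iii) are treated at
    once. *)
Definition Omega_equations (S : nd_solution) (F : set family_name) (k : nat) :=
  forall f : 'I_k -> family_name, (forall j, F (f j)) ->
  forall (x y : S) (z : 'I_k -> S),
    Omega (fun j => family S (f j)) x z = Omega (fun j => family S (f j)) y z.

(** The new entry goes to [ord_max], the index of the outermost map in [Omega]; [unlift] returns
    [None] exactly there, so [a] is the default. *)
Definition ord_rcons {T : Type} {k : nat} (f : 'I_k -> T) (a : T)
    (j : 'I_k.+1) : T :=
  oapp f a (unlift ord_max j).

Lemma ord_rcons_max {T : Type} {k : nat} (f : 'I_k -> T) (a : T) :
  ord_rcons f a ord_max = a.
Proof. by rewrite /ord_rcons unlift_none. Qed.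

Lemma ord_rcons_widen {T : Type} {k : nat} (f : 'I_k -> T) (a : T) :
  (fun j => ord_rcons f a (widen_ord (leqnSn k) j)) = f.
Proof.
apply: funext => j; suff -> : widen_ord (leqnSn k) j = lift ord_max j.
  by rewrite /ord_rcons liftK.
by apply: val_inj; rewrite /= /bump leqNgt ltn_ord.
Qed.

Lemma Omega_rcons (S : nd_solution) (k : nat) (f : 'I_k -> family_name)
    (g : family_name) (x : S) (z : 'I_k -> S) (u : S) :
  Omega (fun j => family S (ord_rcons f g j)) x (ord_rcons z u) =
  family S g (Omega (fun j => family S (f j)) x z) u.
Proof.
rewrite /= !ord_rcons_max ord_rcons_widen.
rewrite (_ : (fun l => _) = fun j => family S (f j)) //.
by apply: funext => j; rewrite -[in RHS](ord_rcons_widen f g).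
Qed.

Lemma Omega_equationsS (S : nd_solution) (F : set family_name) (k : nat) :
  F Sigma -> F Tau ->
  Omega_equations S F k.+1 <-> Omega_equations (Ret S) F k.
Proof.
move=> Fs Ft; split=> [E f Ff C D z|E f Ff x y z].
  have [x ->] := ret_pi_surj C; have [y ->] := ret_pi_surj D.
  (* Representatives in [S] of all the classes [z j]. *)
  have [w zw] := choice (fun j => ret_pi_surj (z j)).
  rewrite (funext zw) !Omega_ret; apply/ret_piP.
  have eqF g : F g -> family S g (Omega (fun j => family S (f j)) x w) =
                      family S g (Omega (fun j => family S (f j)) y w).
    (* Appending the name [g] and the arbitrary point [u] gives an instance of the equations of
       length [k.+1]. *)
    move=> Fg; apply: funext => u; rewrite -!Omega_rcons; apply: E => j.
    by rewrite /ord_rcons; case: unliftP => [i|] _ /=.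
  by split; [exact: (eqF Sigma) | exact: (eqF Tau)].
apply: (congr1 (fun h => h (z ord_max))); apply/family_sim/ret_piP.
rewrite -!(Omega_ret _ _ (fun l => f (widen_ord (leqnSn k) l))).
exact: E.
Qed.

Lemma Omega_equationsP (S : nd_solution) (F : set family_name) (k : nat) :
  F Sigma -> F Tau -> one_element (iter k Ret S) <-> Omega_equations S F k.
Proof.
(* [S] is generalized because the induction step replaces it by [Ret S]. *)
move=> Fs Ft; elim: k S => [|k IH] S.
  split=> [[a aP] f _ x y z|E]; first by rewrite /= (aP x) (aP y).
  have [a] := carrier_inhabited S; exists a => b.
  (* For [k = 0] the equations read [x = y]; both tuples are dummies indexed by the empty ['I_0]. *)
  by apply: (E (fun=> Sigma) _ b a (fun=> a)) => -[].
by rewrite iterSr IH; symmetry; exact: Omega_equationsS.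
Qed.

Lemma Omega_equations_image (S : nd_solution) (F : set family_name) (k : nat) :
  Omega_equations S F k <->
  (forall gamma : 'I_k -> S -> S -> S, (forall j, (family S @` F) (gamma j)) ->
   forall (x y : S) (z : 'I_k -> S), Omega gamma x z = Omega gamma y z).
Proof.
split=> [E gamma gammaF|E f Ff]; last by apply: E => j; exists (f j).
(* Different names may denote equal families, so a name for each [gamma j] has to be chosen. *)
have /choice[f fP] : forall j, exists g, F g /\ family S g = gamma j.
  by move=> j; have [g Fg gE] := gammaF j; exists g.
have -> : gamma = fun j => family S (f j).
  by apply: funext => j; case: (fP j).
by apply: E => j; case: (fP j).
Qed.

Theorem theorem4p4 (S : nd_solution) (k : nat) :
  (multipermutation_level_le S k <->
   (forall gamma : 'I_k -> S -> S -> S,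
      (forall j, [set sigma S; sigma_inv S; tau S; tau_inv S] (gamma j)) ->
      forall (x y : S) (z : 'I_k -> S), Omega gamma x z = Omega gamma y z))
  /\
  (multipermutation_level_le S k <->
   (forall gamma : 'I_k -> S -> S -> S,
      (forall j, [set sigma S; tau S] (gamma j)) ->
      forall (x y : S) (z : 'I_k -> S), Omega gamma x z = Omega gamma y z)).
Proof.
have -> : [set sigma S; sigma_inv S; tau S; tau_inv S] = family S @` setT.
  apply/seteqP; split=> [h [[[]|]|] ->|h [[] _ <-]] /=; try by tauto.
  - by exists Sigma.
  - by exists SigmaInv.
  - by exists Tau.
  - by exists TauInv.
have -> : [set sigma S; tau S] = family S @` [set Sigma; Tau].
  apply/seteqP; split=> [h [] ->|h [g [] -> <-]] /=; try by tauto.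
  - by exists Sigma => //; left.
  - by exists Tau => //; right.
rewrite -!Omega_equations_image multipermutation_level_leP.
by split; apply: Omega_equationsP => //; [left | right].
Qed.
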